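(* Let $B$ be the bull graph, i.e. the graph with vertex set $\{1,2,3,4,5\}$ and edges $\{1,3\},\{2,4\},\{3,4\},\{3,5\},\{4,5\}$ (a triangle with two disjoint pendant edges). Then $B$ is a twin-free singular graph. Let $\mathcal{A}(B)$ and $\mathcal{A}_{RW}(B)$ be the evolution algebras associated to $B$ and to the symmetric random walk on $B$, respectively. If $f:\mathcal{A}_{RW}(B)\to\mathcal{A}(B)$ is a homomorphism, then $f=0$; in particular, the two evolution algebras are not isomorphic.
   Context: A graph is singular if its adjacency matrix is singular, and twin-free if no two distinct vertices have the same set of neighbors. Algebras are over a field $\mathbb{K}$. The algebra $\mathcal{A}(B)$ has basis $e_1,\dots,e_5$ and bilinear product determined by $e_1^2=e_3$, $e_2^2=e_4$, $e_3^2=e_1+e_4+e_5$, $e_4^2=e_2+e_3+e_5$, $e_5^2=e_3+e_4$, and $e_i\cdot e_j=0$ if $i\neq j$. The algebra $\mathcal{A}_{RW}(B)$ has basis $e_1,\dots,e_5$ and bilinear product determined by $e_1^2=e_3$, $e_2^2=e_4$, $e_3^2=\frac13(e_1+e_4+e_5)$, $e_4^2=\frac13(e_2+e_3+e_5)$, $e_5^2=\frac12(e_3+e_4)$, and $e_i\cdot e_j=0$ if $i\neq j$. An algebra homomorphism is a $\mathbb{K}$-linear map $f$ with $f(xy)=f(x)f(y)$ for all $x,y$; an isomorphism is a bijective homomorphism.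
   Formalization: The field must have characteristic other than 2 and 3, and ''f = 0'' is proved only when -1 is not a square in it (otherwise e1,e2 -> v, e5 -> -v, e3,e4 -> 0 with v = e1+e2+i e5 is a nonzero homomorphism); non-isomorphism is proved without the condition on -1. *)

(* Defs.v *)
From HB Require Import structures.
From mathcomp Require Import all_boot all_order all_algebra.

Set Implicit Arguments.
Unset Strict Implicit.
Unset Printing Implicit Defensive.

Import GRing.Theory.
Local Open Scope ring_scope.

Record sgraph (n : nat) := SGraph {
  adj :> rel 'I_n;
  adj_sym : symmetric adj;
  adj_irrefl : irreflexive adj }.

Definition nbh n (G : sgraph n) (u : 'I_n) : {set 'I_n} := [set v | G u v].

Definition twin_free n (G : sgraph n) : Prop :=
  forall u v : 'I_n, u != v -> nbh G u != nbh G v.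

Definition adjmx (R : pzRingType) n (G : sgraph n) : 'M[R]_n :=
  \matrix_(i, j) (G i j)%:R.

(* Singularity of a graph is a property of its rational adjacency matrix; it
   does not depend on the field over which the algebras are taken. *)
Definition singular n (G : sgraph n) : Prop := adjmx rat G \notin unitmx.

(* Transition matrix of the symmetric random walk. *)
Definition rwmx (K : fieldType) n (G : sgraph n) : 'M[K]_n :=
  \matrix_(i, j) ((G i j)%:R / #|nbh G i|%:R).

(* Algebras are neither associative nor unital, unlike MathComp's algType. *)
Record algebra (K : fieldType) := MkAlgebra {
  alg_sort :> lmodType K;
  alg_mul : alg_sort -> alg_sort -> alg_sort;
  alg_mul_linearr : forall x, linear (alg_mul x);
  alg_mul_linearl : forall y, linear (alg_mul^~ y) }.

Definition alg_hom (K : fieldType) (A B : algebra K) (f : A -> B) : Prop :=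
  linear f /\ {morph f : x y / alg_mul x y}.

Definition alg_isomorphic (K : fieldType) (A B : algebra K) : Prop :=
  exists f : A -> B, alg_hom f /\ bijective f.

(* The evolution algebra with structure matrix M, in its natural basis
   e_i = delta_mx 0 i: e_i * e_i = row i M and e_i * e_j = 0 for i != j. *)
Section EvolutionAlgebra.
Variables (K : fieldType) (n : nat) (M : 'M[K]_n).

Definition evol_mul (x y : 'rV[K]_n) : 'rV[K]_n :=
  \sum_i (x 0 i * y 0 i) *: row i M.

Lemma evol_mulC x y : evol_mul x y = evol_mul y x.
Proof. by apply: eq_bigr => i _; rewrite mulrC. Qed.

Lemma evol_mul_linearr x : linear (evol_mul x).
Proof.
move=> a y z; rewrite /evol_mul scaler_sumr -big_split; apply: eq_bigr => i _.
by rewrite !mxE mulrDr scalerDl mulrCA scalerA.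
Qed.

Lemma evol_mul_linearl y : linear (evol_mul^~ y).
Proof. by move=> a x z; rewrite !(evol_mulC _ y) evol_mul_linearr. Qed.

Definition evol_alg : algebra K :=
  MkAlgebra evol_mul_linearr evol_mul_linearl.

Lemma evol_mul_basis i j :
  evol_mul (delta_mx 0 i) (delta_mx 0 j) = if i == j then row i M else 0.
Proof.
rewrite /evol_mul (bigD1 i) //= big1 => [|k /negPf ki].
  rewrite !mxE !eqxx mul1r addr0 /=.
  by case: (i == j); rewrite ?scale1r ?scale0r.
by rewrite !mxE ki andbF mul0r scale0r.
Qed.

End EvolutionAlgebra.

Definition graph_alg (K : fieldType) n (G : sgraph n) : algebra K :=
  evol_alg (adjmx K G).

Definition rw_alg (K : fieldType) n (G : sgraph n) : algebra K :=
  evol_alg (rwmx K G).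

(* Vertices are listed with labels 1, ..., 5; the vertex labelled k is the
   element of 'I_5 of value k - 1. *)
Definition bull_edges : seq (nat * nat) :=
  [:: (1, 3); (2, 4); (3, 4); (3, 5); (4, 5)]%N.

Definition bull_adj : rel 'I_5 := fun i j =>
  ((i.+1, j.+1) \in bull_edges) || ((j.+1, i.+1) \in bull_edges).

Lemma bull_adj_sym : symmetric bull_adj.
Proof. by move=> i j; rewrite /bull_adj orbC. Qed.

Lemma bull_adj_irrefl : irreflexive bull_adj.
Proof. by move=> [[|[|[|[|[|i]]]]] Hi]. Qed.

Definition bull : sgraph 5 := SGraph bull_adj_sym bull_adj_irrefl.

(* The multiplication tables of the two algebras of the bull graph. *)
Section BullTables.
Variable K : fieldType.

Let e (k : nat) : 'rV[K]_5 := delta_mx 0 (inord k.-1).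
Let sq (A : algebra K) (x : A) : A := alg_mul x x.

Lemma bull_graph_alg_table (A := graph_alg K bull) :
  [/\ sq (e 1 : A) = e 3, sq (e 2 : A) = e 4,
      sq (e 3 : A) = e 1 + e 4 + e 5, sq (e 4 : A) = e 2 + e 3 + e 5
    & sq (e 5 : A) = e 3 + e 4].
Proof.
split; rewrite /sq /= evol_mul_basis eqxx; apply/rowP=> -[[|[|[|[|[|j]]]]] Hj] //;
by rewrite !mxE /adj /= /bull_adj -!val_eqE /= !inordK //= ?(addr0, add0r).
Qed.

Lemma card_bull_nbh (i : 'I_5) :
  #|nbh bull i| = nth 0%N [:: 1; 1; 3; 3; 2]%N i.
Proof.
rewrite cardsE -sum1_card big_mkcond /= !big_ord_recl big_ord0.
by case: i => [[|[|[|[|[|i]]]]] Hi].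
Qed.

Lemma bull_rw_alg_table (A := rw_alg K bull) :
  [/\ sq (e 1 : A) = e 3, sq (e 2 : A) = e 4,
      sq (e 3 : A) = 3^-1 *: (e 1 + e 4 + e 5),
      sq (e 4 : A) = 3^-1 *: (e 2 + e 3 + e 5)
    & sq (e 5 : A) = 2^-1 *: (e 3 + e 4)].
Proof.
split; rewrite /sq /= evol_mul_basis eqxx; apply/rowP=> -[[|[|[|[|[|j]]]]] Hj] //;
by rewrite !mxE card_bull_nbh /adj /= /bull_adj -!val_eqE /= !inordK //=
  ?(addr0, add0r, mul0r, mul1r, mulr0, mulr1, invr1).
Qed.

End BullTables.

(* Main.v *)
(** Let [a i] be the image of the basis vector [e_i]. Off the diagonal, the
    relations [a i * a j = 0] say that columns 3 and 4 of the matrix of [a] have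
    at most one nonzero entry, and that the products of the entries in rows [i]
    and [j] agree for columns 1 and 2 and are opposite for column 5.
    If column 1 has three nonzero entries, then comparing it with column 5 gives
    a square root of -1, and comparing it with column 2 shows that these two are
    proportional, so that the homomorphism is not onto.
    If it has exactly two, the three columns have the same support and the
    squares force [a = 0].
    Otherwise the rows have disjoint supports: a zero row forces [a = 0], and if
    no row vanishes the matrix is monomial, with nonzero entries subject to
    inconsistent equations. *)

Require Import Defs.
From HB Require Import structures.
From mathcomp Require Import all_boot all_order all_algebra.
From mathcomp Require Import ring.

Set Implicit Arguments.
Unset Strict Implicit.
Unset Printing Implicit Defensive.

Import GRing.Theory.
Local Open Scope ring_scope.

(** * Vertices and twin-freeness of the bull *)

Definition vtx (k : nat) : 'I_5 := inord k.-1.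

Lemma vtxP (P : 'I_5 -> Prop) :
  P (vtx 1) -> P (vtx 2) -> P (vtx 3) -> P (vtx 4) -> P (vtx 5) ->
  forall i, P i.
Proof.
have vE (k : nat) (lt_k5 : (k < 5)%N) : Ordinal lt_k5 = vtx k.+1.
  by apply: val_inj; rewrite /= inordK.
by move=> P1 P2 P3 P4 P5 [[|[|[|[|[|k]]]]] lt_k5] //; rewrite vE.
Qed.

Lemma vtx_eq (k l : nat) :
  (k.-1 < 5)%N -> (l.-1 < 5)%N -> (vtx k == vtx l) = (k.-1 == l.-1).
Proof. by move=> k5 l5; rewrite -val_eqE /= !inordK. Qed.

Lemma bull_twin_free : twin_free bull.
Proof.
move=> u v; apply: contraNneq => /setP nbh_uv.
move: (nbh_uv (vtx 1)) (nbh_uv (vtx 2)) (nbh_uv (vtx 3)) (nbh_uv (vtx 4)).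
move: (nbh_uv (vtx 5)); rewrite !inE {nbh_uv} /= /bull_adj /vtx !inordK //.
by move: u v => [[|[|[|[|[|u]]]]] ?] [[|[|[|[|[|v]]]]] ?].
Qed.

(** * Products in the graph algebra and relations among the images of the basis *)

Section BullHom.
Variable K : fieldType.
Implicit Types x y : 'rV[K]_5.

Local Notation "x .[ k ]" := (x 0 (vtx k)) : ring_scope.
Local Notation mul := (evol_mul (adjmx K bull)).

Lemma bull_mulE x y :
  [/\ (mul x y).[1] = x.[3] * y.[3], (mul x y).[2] = x.[4] * y.[4],
      (mul x y).[3] = x.[1] * y.[1] + x.[4] * y.[4] + x.[5] * y.[5],
      (mul x y).[4] = x.[2] * y.[2] + x.[3] * y.[3] + x.[5] * y.[5]
    & (mul x y).[5] = x.[3] * y.[3] + x.[4] * y.[4]].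
Proof.
have sumE (F : 'I_5 -> K) : \sum_i F i =
    F (vtx 1) + F (vtx 2) + F (vtx 3) + F (vtx 4) + F (vtx 5).
  rewrite !big_ord_recr big_ord0 /= add0r.
  by congr (F _ + F _ + F _ + F _ + F _); apply: val_inj; rewrite /= inordK.
split; rewrite summxE sumE !mxE /= /bull_adj /vtx !inordK //= ; ring.
Qed.

Lemma rowP_vtx x y :
  x.[1] = y.[1] -> x.[2] = y.[2] -> x.[3] = y.[3] -> x.[4] = y.[4] ->
  x.[5] = y.[5] -> x = y.
Proof. by move=> *; apply/rowP; apply: vtxP. Qed.

Lemma bull_mul_eq0 x y : mul x y = 0 ->
  [/\ x.[3] * y.[3] = 0, x.[4] * y.[4] = 0, x.[2] * y.[2] = x.[1] * y.[1]
    & x.[5] * y.[5] = - (x.[1] * y.[1])].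
Proof.
move=> xy0; have := bull_mulE x y; rewrite xy0 !mxE => -[<- <-].
rewrite !addr0 => e3 e4 _.
have e5 : x.[5] * y.[5] = - (x.[1] * y.[1]).
  by apply/eqP; rewrite -addr_eq0 addrC -e3.
by split=> //; apply/eqP; rewrite -subr_eq0 -e5 -e4.
Qed.

Lemma bull_mul0 : mul 0 0 = 0.
Proof. by apply: big1 => i _; rewrite mxE mul0r scale0r. Qed.

Lemma bull_mulNr x y : mul x (- y) = - mul x y.
Proof.
by rewrite /evol_mul -sumrN; apply: eq_bigr => i _; rewrite mxE mulrN scaleNr.
Qed.

Hypothesis K2 : (2 : K) != 0.

(** The relations that a homomorphism imposes on the images of the basis vectors, with the
    denominators 3 and 2 of the random walk cleared. *)
Record bull_hom (a : 'I_5 -> 'rV[K]_5) : Prop := BullHom {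
  hom_off : forall i j, i != j -> mul (a i) (a j) = 0;
  hom_sq1 : mul (a (vtx 1)) (a (vtx 1)) = a (vtx 3);
  hom_sq2 : mul (a (vtx 2)) (a (vtx 2)) = a (vtx 4);
  hom_sq3 : 3 *: mul (a (vtx 3)) (a (vtx 3)) =
            a (vtx 1) + a (vtx 4) + a (vtx 5);
  hom_sq4 : 3 *: mul (a (vtx 4)) (a (vtx 4)) =
            a (vtx 2) + a (vtx 3) + a (vtx 5);
  hom_sq5 : 2 *: mul (a (vtx 5)) (a (vtx 5)) = a (vtx 3) + a (vtx 4) }.

(* The automorphism of the bull; it also preserves the relations [bull_hom]. *)
Definition bull_swap (i : 'I_5) : 'I_5 :=
  nth ord0 [:: vtx 2; vtx 1; vtx 4; vtx 3; vtx 5] i.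

Lemma bull_swapE : [/\ bull_swap (vtx 1) = vtx 2, bull_swap (vtx 2) = vtx 1,
  bull_swap (vtx 3) = vtx 4, bull_swap (vtx 4) = vtx 3
  & bull_swap (vtx 5) = vtx 5].
Proof. by rewrite /bull_swap {1 3 5 7 9}/vtx !inordK. Qed.

Lemma bull_swapK : involutive bull_swap.
Proof. by have [s1 s2 s3 s4 s5] := bull_swapE; apply: vtxP; congruence. Qed.

Lemma bull_hom_swap a : bull_hom a -> bull_hom (a \o bull_swap).
Proof.
have [s1 s2 s3 s4 s5] := bull_swapE.
case=> off e1 e2 e3 e4 e5; split; rewrite /= ?(s1, s2, s3, s4, s5) //.
  by move=> i j ij; apply: off; rewrite (can_eq bull_swapK).
by rewrite addrC.
Qed.

(** With a_i for [a (vtx i)]: a_3 = a_1^2 = 0, so the third square gives a_4 = -a_5. Then a_5^2 =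
    -a_5 a_4 = 0, the fifth square gives a_4 = 0, and the fourth leaves a_2 = 0. *)
Lemma bull_hom_eq0 a : bull_hom a -> a (vtx 1) = 0 -> forall i, a i = 0.
Proof.
case=> off e1 e2 e3 e4 e5 a1.
have a3 : a (vtx 3) = 0 by rewrite -e1 a1 bull_mul0.
have a4 : a (vtx 4) = - a (vtx 5).
  apply/eqP; rewrite -addr_eq0; move/eqP: e3.
  by rewrite a3 a1 bull_mul0 scaler0 add0r eq_sym.
have a55 : mul (a (vtx 5)) (a (vtx 5)) = 0.
  by apply: oppr_inj; rewrite oppr0 -bull_mulNr -a4 off // vtx_eq.
have a40 : a (vtx 4) = 0 by rewrite -[LHS]add0r -a3 -e5 a55 scaler0.
have a50 : a (vtx 5) = 0 by apply: oppr_inj; rewrite -a4 oppr0.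
apply: vtxP => //.
by move: e4; rewrite a3 a40 a50 !addr0 bull_mul0 scaler0.
Qed.

Lemma bull_hom_eq0' a : bull_hom a -> a (vtx 2) = 0 -> forall i, a i = 0.
Proof.
move=> /bull_hom_swap/bull_hom_eq0; have [/= -> _ _ _ _] := bull_swapE.
by move=> a0 /a0 {}a0 i; rewrite -[i]bull_swapK a0.
Qed.

Lemma bull_hom_off a i j : bull_hom a -> i != j ->
  [/\ (a i).[3] * (a j).[3] = 0, (a i).[4] * (a j).[4] = 0,
      (a i).[2] * (a j).[2] = (a i).[1] * (a j).[1]
    & (a i).[5] * (a j).[5] = - ((a i).[1] * (a j).[1])].
Proof. by move=> [off _ _ _ _ _] /off/bull_mul_eq0. Qed.

Lemma sqr_eq0 (t : K) : t * t = 0 -> t = 0.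
Proof. by move/eqP; rewrite mulf_eq0 orbb => /eqP. Qed.

(** * Columns 1, 2 and 5 with equal supports *)

Definition same_support (a : 'I_5 -> 'rV[K]_5) : Prop :=
  forall i, ((a i).[2] == 0) = ((a i).[1] == 0) /\
            ((a i).[5] == 0) = ((a i).[1] == 0).

(** Row a_1 vanishes in columns 1, 2 and 5. Columns 1 and 2 of a_3 = a_1^2 hold the squares of
    entries 3 and 4 of a_1, so these vanish together. Column 3 of a_3 is the square of entry 4, so
    a_1 a_3 = 0 kills both. *)
Lemma bull_hom_eq0_coord a : bull_hom a -> same_support a ->
  (a (vtx 1)).[1] = 0 -> forall i, a i = 0.
Proof.
move=> homa suppa a11; apply: bull_hom_eq0 => //.
have [_ e1 _ _ _ _] := homa.
have [z12 z15] := suppa (vtx 1); have [z32 _] := suppa (vtx 3).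
have {z12} a12 : (a (vtx 1)).[2] = 0 by apply/eqP; rewrite z12 a11.
have {z15} a15 : (a (vtx 1)).[5] = 0 by apply/eqP; rewrite z15 a11.
have [m1 m2 m3 _ _] := bull_mulE (a (vtx 1)) (a (vtx 1)).
rewrite e1 in m1 m2 m3; rewrite m1 m2 in z32.
have d13 : vtx 1 != vtx 3 by rewrite vtx_eq.
have [o3 _ _ _] := bull_hom_off homa d13.
have [a13 a14] : (a (vtx 1)).[3] = 0 /\ (a (vtx 1)).[4] = 0.
  rewrite !mulf_eq0 !orbb in z32.
  move/eqP: o3; rewrite m3 a11 a15 !mul0r add0r addr0 !mulf_eq0 orbb z32 orbb.
  by move=> a13; split; apply/eqP; rewrite ?z32.
by apply: rowP_vtx; rewrite mxE.
Qed.

Lemma bull_hom_two a : bull_hom a -> same_support a ->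
  (forall i j k, i != j -> i != k -> j != k ->
     (a i).[1] * (a j).[1] * (a k).[1] = 0) ->
  forall i, a i = 0.
Proof.
move=> homa suppa two.
have [s1 s2 s3 s4 s5] := bull_swapE.
have [/(bull_hom_eq0_coord homa suppa)//|a11] := eqVneq (a (vtx 1)).[1] 0.
have [a21|a21] := eqVneq (a (vtx 2)).[1] 0.
  have := bull_hom_eq0_coord (bull_hom_swap homa) (fun i => suppa _).
  by rewrite /= s1 => /(_ a21) a0 i; rewrite -[i]bull_swapK a0.
(* Rows 1 and 2 now hold the only nonzero entries of column 1; the fifth square, then the third,
   will force [a11] to fail. *)
have zero k : vtx k != vtx 1 -> vtx k != vtx 2 -> (a (vtx k)).[1] = 0.
  rewrite ![vtx k == _]eq_sym => k1 k2.
  have d12 : vtx 1 != vtx 2 by rewrite vtx_eq.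
  have /eqP := two (vtx 1) (vtx 2) (vtx k) d12 k1 k2.
  by rewrite !mulf_eq0 (negPf a11) (negPf a21) => /eqP.
have [a31 a41 a51] : [/\ (a (vtx 3)).[1] = 0, (a (vtx 4)).[1] = 0
  & (a (vtx 5)).[1] = 0] by split; apply: zero; rewrite vtx_eq.
have a55 : (a (vtx 5)).[5] = 0.
  by apply/eqP; have [_ ->] := suppa (vtx 5); apply/eqP.
have a32 : (a (vtx 3)).[2] = 0.
  by apply/eqP; have [-> _] := suppa (vtx 3); apply/eqP.
have a42 : (a (vtx 4)).[2] = 0.
  by apply/eqP; have [-> _] := suppa (vtx 4); apply/eqP.
have [_ _ _ e3 _ e5] := homa.
have [_ m2 m3 _ _] := bull_mulE (a (vtx 5)) (a (vtx 5)).
have a54 : (a (vtx 5)).[4] = 0.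
  move/(congr1 (fun x => x.[2])): e5; rewrite !mxE m2 a32 a42 addr0 => /eqP.
  by rewrite mulf_eq0 (negPf K2) => /eqP/sqr_eq0.
have a34 : (a (vtx 3)).[3] + (a (vtx 4)).[3] = 0.
  move/(congr1 (fun x => x.[3])): e5.
  by rewrite !mxE m3 a51 a54 a55 !mul0r !addr0 mulr0 => <-.
have d34 : vtx 3 != vtx 4 by rewrite vtx_eq.
have [o3 _ _ _] := bull_hom_off homa d34.
have a33 : (a (vtx 3)).[3] * (a (vtx 3)).[3] = 0.
  by rewrite -[LHS]addr0 -o3 -mulrDr a34 mulr0.
move/(congr1 (fun x => x.[1])): e3.
have [m1 _ _ _ _] := bull_mulE (a (vtx 3)) (a (vtx 3)).
rewrite !mxE m1 a33 a41 a51 mulr0 !addr0 => a110.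
by rewrite -a110 eqxx in a11.
Qed.

(** * Rows with disjoint supports *)

(** A basis vector squares to the sum of its neighbours, which is a single term only at the pendant
    vertices 1 and 2. *)
Lemma square_single x y : mul x x = y -> x != 0 ->
  (forall k l, k != l -> x 0 k * x 0 l = 0) ->
  (forall k l, k != l -> y 0 k * y 0 l = 0) ->
  exists t : K, exists b : bool,
    [/\ x = t *: delta_mx 0 (vtx (if b then 1 else 2)), t != 0
      & y = t ^+ 2 *: delta_mx 0 (vtx (if b then 3 else 4))].
Proof.
move=> <- x0 sx; have [y1 y2 y3 y4 y5] := bull_mulE x x; move=> sy.
have sx' k l : (k.-1 < 5)%N -> (l.-1 < 5)%N -> k.-1 != l.-1 ->
    x.[k] * x.[l] = 0.
  by move=> k5 l5; rewrite -vtx_eq // => /sx.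
have sy' k l : (k.-1 < 5)%N -> (l.-1 < 5)%N -> k.-1 != l.-1 ->
    (mul x x).[k] * (mul x x).[l] = 0.
  by move=> k5 l5; rewrite -vtx_eq // => /sy.
(* The fourth power of each of the coordinates 3, 4, 5 is a polynomial in products of distinct
   coordinates of [x] or of its square, all zero. *)
have x3 : x.[3] = 0.
  apply/sqr_eq0/sqr_eq0.
  transitivity ((mul x x).[1] * (mul x x).[5] - (x.[3] * x.[4]) ^+ 2).
    by rewrite y1 y5; ring.
  by rewrite sy' // sx' // expr0n subr0.
have x4 : x.[4] = 0.
  apply/sqr_eq0/sqr_eq0; have := sy' 2%N 5%N isT isT isT.
  by rewrite y2 y5 x3 mul0r add0r.
have x5 : x.[5] = 0.
  apply/sqr_eq0/sqr_eq0.
  transitivity ((mul x x).[3] * (mul x x).[4] - (x.[1] * x.[2]) ^+ 2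
                - (x.[1] * x.[5]) ^+ 2 - (x.[2] * x.[5]) ^+ 2).
    by rewrite y3 y4 x3 x4; ring.
  by rewrite sy' // !sx' // expr0n !subr0.
rewrite x3 x4 x5 !mul0r !(addr0, add0r) in y1 y2 y3 y4 y5.
have /eqP := sx' 1%N 2%N isT isT isT.
rewrite mulf_eq0 => /orP[/eqP x1|/eqP x2].
  have xE : x = x.[2] *: delta_mx 0 (vtx 2).
    by apply: rowP_vtx; rewrite !mxE !vtx_eq //= ?(mulr1, mulr0).
  exists x.[2], false; split=> //.
    by apply: contra_neq x0 => x2; rewrite xE x2 scale0r.
  by apply: rowP_vtx; rewrite !mxE !vtx_eq //= ?(mulr1, mulr0) // y3 x1 mul0r.
have xE : x = x.[1] *: delta_mx 0 (vtx 1).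
  by apply: rowP_vtx; rewrite !mxE !vtx_eq //= ?(mulr1, mulr0).
exists x.[1], true; split=> //.
  by apply: contra_neq x0 => x1; rewrite xE x1 scale0r.
by apply: rowP_vtx; rewrite !mxE !vtx_eq //= ?(mulr1, mulr0) // y4 x2 mul0r.
Qed.

Lemma bull_hom_disjoint a : bull_hom a ->
  (forall i j, i != j -> forall k, a i 0 k * a j 0 k = 0) -> forall i, a i = 0.
Proof.
move=> homa disj.
have [[i ai0]|nz] : (exists i, a i = 0) \/ forall i, a i != 0.
  have [/existsP[i /eqP]|] := boolP [exists i, a i == 0].
    by left; exists i.
  by rewrite negb_exists => /forallP nz; right.
- have d34 : vtx 3 != vtx 4 by rewrite vtx_eq.
  have d14 : vtx 1 != vtx 4 by rewrite vtx_eq.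
  have d15 : vtx 1 != vtx 5 by rewrite vtx_eq.
  have d23 : vtx 2 != vtx 3 by rewrite vtx_eq.
  have d25 : vtx 2 != vtx 5 by rewrite vtx_eq.
  have [_ e1 e2 e3 e4 e5] := homa.
  (* Multiplying 0 = a_1 + a_4 + a_5 entrywise by a_1 isolates a_1, since supports are disjoint;
     [z2] and [z5] work alike. *)
  have z1 : a (vtx 3) = 0 -> forall i, a i = 0.
    move=> a3; apply: bull_hom_eq0 => //; apply/rowP=> k.
    move/(congr1 (fun x => a (vtx 1) 0 k * x 0 k)): e3.
    rewrite a3 bull_mul0 !mxE !mulrDr (disj _ _ d14) (disj _ _ d15).
    by rewrite !mulr0 !addr0 => /esym/sqr_eq0.
  have z2 : a (vtx 4) = 0 -> forall i, a i = 0.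
    move=> a4; apply: bull_hom_eq0' => //; apply/rowP=> k.
    move/(congr1 (fun x => a (vtx 2) 0 k * x 0 k)): e4.
    rewrite a4 bull_mul0 !mxE !mulrDr (disj _ _ d23) (disj _ _ d25).
    by rewrite !mulr0 !addr0 => /esym/sqr_eq0.
  have z5 : a (vtx 5) = 0 -> forall i, a i = 0.
    move=> a5; apply: z1; apply/rowP=> k.
    move/(congr1 (fun x => a (vtx 3) 0 k * x 0 k)): e5.
    rewrite a5 bull_mul0 !mxE !mulrDr (disj _ _ d34).
    by rewrite !mulr0 !addr0 => /esym/sqr_eq0.
  move: i ai0; apply: vtxP => //; first exact: bull_hom_eq0.
  exact: bull_hom_eq0'.
exfalso.
have nzP i : exists k, a i 0 k != 0 by apply/rV0Pn.
(* Disjointness makes this choice of a nonzero column injective, hence bijective, so row [i] lives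
   in column [s i] alone. *)
pose s i := xchoose (nzP i).
have sN i : a i 0 (s i) != 0 := xchooseP (nzP i).
have sI : injective s.
  move=> i j sij; apply/eqP/negPn/negP => /disj/(_ (s i))/eqP.
  by rewrite mulf_eq0 {2}sij (negPf (sN i)) (negPf (sN j)).
have single i k l : k != l -> a i 0 k * a i 0 l = 0.
  have [g gK sK] := injF_bij sI.
  have off m : m != s i -> a i 0 m = 0.
    move=> m_si; have gm_i : i != g m.
      by apply: contra_neq m_si => ->; rewrite sK.
    have := sN (g m); rewrite sK => agm.
    by have /eqP := disj _ _ gm_i m; rewrite mulf_eq0 (negPf agm) orbF => /eqP.
  have [->|/off-> _] := eqVneq k (s i); last exact: mul0r.
  by rewrite eq_sym => /off->; rewrite mulr0.
have [_ e1 e2 e3 e4 _] := homa.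
have [t [b [x1 t0 x3]]] := square_single e1 (nz _) (single _) (single _).
have [u [c [x2 u0 x4]]] := square_single e2 (nz _) (single _) (single _).
(* Coordinates of the third and fourth squares, [w] being the entry of a_5. They give t = w = u and
   u^2 = u, so u = 1 and 3 = 1, against [K2]. *)
have key w : 3 * (t ^+ 2 * t ^+ 2) = t -> 3 * (t ^+ 2 * t ^+ 2) = u ^+ 2 ->
    3 * (t ^+ 2 * t ^+ 2) = w -> 3 * (u ^+ 2 * u ^+ 2) = u ->
    3 * (u ^+ 2 * u ^+ 2) = w -> False.
  move=> tt tu tw uu uw; have tE : t = u by rewrite -tt tw -uw.
  have u1 : u = 1.
    by apply: (mulfI u0); rewrite mulr1 -expr2 -tu tt.
  move: uu; rewrite u1 !expr1n !mulr1 => three1; move/eqP: K2; apply.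
  by apply: (addrI 1); rewrite addr0 -[RHS]three1 nat1r.
have zero i j k : (a i).[k] != 0 -> i != j -> (a j).[k] = 0.
  move=> aik /disj/(_ (vtx k))/eqP; rewrite mulf_eq0 (negPf aik) => /eqP//.
have [m1 m2 m3 m4 m5] := bull_mulE (a (vtx 3)) (a (vtx 3)).
have [n1 n2 n3 n4 n5] := bull_mulE (a (vtx 4)) (a (vtx 4)).
have E3 k := congr1 (fun x : 'rV[K]_5 => x.[k]) e3.
have E4 k := congr1 (fun x : 'rV[K]_5 => x.[k]) e4.
(* Rows 1 and 2 occupy different columns: up to scalars, only the identity and the automorphism of
   the bull remain. *)
have cb : c = ~~ b.
  have d12 : vtx 1 != vtx 2 by rewrite vtx_eq.
  have := disj _ _ d12 (vtx (if b then 1 else 2)); rewrite x1 x2.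
  case: b c {x1 x2 x3 x4} => [] []; rewrite ?mxE ?vtx_eq //= !mulr1 => /eqP;
  by rewrite mulf_eq0 (negPf t0) (negPf u0).
rewrite {c}cb in x2 x4.
have a5 : [/\ (a (vtx 5)).[1] = 0, (a (vtx 5)).[2] = 0, (a (vtx 5)).[3] = 0
  & (a (vtx 5)).[4] = 0].
  have d i : (i.-1 < 4)%N -> vtx i != vtx 5.
    by move=> i4; rewrite vtx_eq ?(ltn_eqF i4) // ltnS ltnW.
  split; [apply: (zero (vtx (if b then 1 else 2)))
    | apply: (zero (vtx (if b then 2 else 1)))
    | apply: (zero (vtx (if b then 3 else 4)))
    | apply: (zero (vtx (if b then 4 else 3)))]; case: (b) x1 x2 x3 x4;
  rewrite /= => x1 x2 x3 x4;
  rewrite ?d // ?x1 ?x2 ?x3 ?x4 !mxE !vtx_eq //= mulr1;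
  by rewrite // expf_neq0.
have {}E3 k : 3 * (mul (a (vtx 3)) (a (vtx 3))).[k] =
    (a (vtx 1)).[k] + (a (vtx 4)).[k] + (a (vtx 5)).[k].
  by have := E3 k; rewrite !mxE.
have {}E4 k : 3 * (mul (a (vtx 4)) (a (vtx 4))).[k] =
    (a (vtx 2)).[k] + (a (vtx 3)).[k] + (a (vtx 5)).[k].
  by have := E4 k; rewrite !mxE.
have [a51 a52 a53 a54] := a5.
move: (E3 1%N) (E3 2%N) (E3 3%N) (E3 4%N) (E3 5%N) (E4 1%N) (E4 2%N) (E4 5%N).
rewrite m1 m2 m3 m4 m5 n1 n2 n5 a51 a52 a53 a54.
case: b x1 x2 x3 x4 => /= -> -> -> ->; rewrite !mxE !vtx_eq //=;
  rewrite !(mulr1, mulr0, mul0r, addr0, add0r) => *;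
  exact: (key (a (vtx 5)).[5]).
Qed.

(** * Case distinction on column 1, and the case of three nonzero entries *)

Lemma bull_hom_triple a : bull_hom a ->
  (forall i, a i = 0) \/
  exists i j k, [/\ i != j, i != k, j != k
    & (a i).[1] * (a j).[1] * (a k).[1] != 0].
Proof.
move=> homa.
case: (boolP [exists i, [exists j, [exists k,
  [&& i != j, i != k, j != k & (a i).[1] * (a j).[1] * (a k).[1] != 0]]]]).
  move=> /existsP[i /existsP[j /existsP[k /and4P[*]]]].
  by right; exists i, j, k.
move=> no3; left.
have two i j k : i != j -> i != k -> j != k ->
     (a i).[1] * (a j).[1] * (a k).[1] = 0.
  move=> ij ik jk; apply/eqP; apply: contraNT no3 => nz.
  by apply/existsP; exists i; apply/existsP; exists j; apply/existsP; exists k;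
    apply/and4P.
have [/existsP[i /existsP[j /andP[ij nz]]]|no2] := boolP
  [exists i, [exists j, (i != j) && ((a i).[1] * (a j).[1] != 0)]].
  apply: bull_hom_two => //.
  have [_ _ p2 p5] := bull_hom_off homa ij.
  have := nz; rewrite mulf_eq0 negb_or => /andP[i1 j1].
  have := nz; rewrite -p2 mulf_eq0 negb_or => /andP[i2 _].
  have := nz; rewrite -oppr_eq0 -p5 mulf_eq0 negb_or => /andP[i5 _].
  (* Row [i] is nonzero in columns 1, 2 and 5, so its products with row [l] make the entries of row
     [l] there vanish together. *)
  move=> l; have [->|li] := eqVneq l i.
    by rewrite (negPf i1) (negPf i2) (negPf i5).
  have [_ _ /(congr1 (eq_op^~ 0)) q2 /(congr1 (eq_op^~ 0)) q5] :=
    bull_hom_off homa li.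
  rewrite /= ?oppr_eq0 !mulf_eq0 (negPf i1) (negPf i2) (negPf i5) !orbF
    in q2 q5.
  by rewrite q2 q5.
have off1 i j : i != j -> (a i).[1] * (a j).[1] = 0.
  move=> ij; apply/eqP; apply: contraNT no2 => nz.
  by apply/existsP; exists i; apply/existsP; exists j; rewrite ij.
apply: bull_hom_disjoint => // i j ij k.
have [o3 o4 o2 o5] := bull_hom_off homa ij.
rewrite (off1 _ _ ij) in o2 o5; rewrite oppr0 in o5.
by move: k; apply: vtxP => //; apply: off1.
Qed.

(** In column 5 the products ij and ik multiply to the same value as in column 1, while jk changes
    sign; dividing, the squared entry of row [i] changes sign too. *)
Lemma bull_hom_triple_sqrtN1 a i j k : bull_hom a ->
  i != j -> i != k -> j != k -> (a i).[1] * (a j).[1] * (a k).[1] != 0 ->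
  exists t : K, t ^+ 2 = -1.
Proof.
move=> homa ij ik jk; rewrite !mulf_eq0 !negb_or => /andP[/andP[i1 j1] k1].
have [_ _ _ oij] := bull_hom_off homa ij.
have [_ _ _ oik] := bull_hom_off homa ik.
have [_ _ _ ojk] := bull_hom_off homa jk.
exists ((a i).[5] / (a i).[1]); rewrite expr_div_n.
apply: (mulIf (expf_neq0 2 i1)); rewrite divfK ?expf_neq0 //.
apply: (mulIf (mulf_neq0 j1 k1)); apply: oppr_inj; rewrite -mulrN -ojk.
transitivity (((a i).[5] * (a j).[5]) * ((a i).[5] * (a k).[5])); first by ring.
by rewrite oij oik; ring.
Qed.

(** One of [j], [k] differs from [l]; pairing rows [i] and [l] with that row and cancelling its
    second entry gives the proportionality. *)
Lemma bull_hom_triple_col a i j k : bull_hom a ->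
  i != j -> i != k -> j != k -> (a i).[1] * (a j).[1] * (a k).[1] != 0 ->
  forall l, (a i).[1] * (a l).[2] = (a i).[2] * (a l).[1].
Proof.
move=> homa ij ik jk; rewrite !mulf_eq0 !negb_or => /andP[/andP[i1 j1] k1] l.
have prop m : i != m -> l != m -> (a m).[1] != 0 ->
    (a i).[1] * (a l).[2] = (a i).[2] * (a l).[1].
  move=> im lm m1; have [_ _ oim _] := bull_hom_off homa im.
  have [_ _ olm _] := bull_hom_off homa lm.
  have m2 : (a m).[2] != 0.
    by apply: contra_neq (mulf_neq0 i1 m1) => m2; rewrite -oim m2 mulr0.
  by apply: (mulIf m2); rewrite -mulrA olm mulrAC oim; ring.
have [lj|lj] := eqVneq l j; first by apply: (prop k); rewrite ?lj.
exact: (prop j).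
Qed.

End BullHom.

(** * Singularity of the bull *)

Lemma bull_singular : singular bull.
Proof.
apply/negP => unitA.
(* A kernel vector: the neighbours of 5 are 3 and 4, the sole neighbours of 1 and 2. *)
pose u : 'rV[rat]_5 :=
  delta_mx 0 (vtx 1) + delta_mx 0 (vtx 2) - delta_mx 0 (vtx 5).
have uA : u *m adjmx rat bull = 0.
  rewrite mulmxBl mulmxDl -!rowE; apply: rowP_vtx;
  by rewrite !mxE /= /bull_adj /vtx !inordK.
have /rowP/(_ (vtx 1)) : u = 0 by rewrite -[u](mulmxK unitA) uA mul0mx.
by rewrite !mxE !vtx_eq.
Qed.

(** * From homomorphisms to the images of the basis *)

Section BullAlgebraHom.
Variable K : fieldType.
Hypotheses (K2 : (2 : K) != 0) (K3 : (3 : K) != 0).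
Variable f : rw_alg K bull -> graph_alg K bull.
Hypothesis homf : alg_hom f.

Let img i : 'rV[K]_5 := f (delta_mx 0 i : 'rV[K]_5).

Lemma alg_hom_sum (x : 'rV[K]_5) : f x = \sum_i x 0 i *: img i.
Proof.
have [lin_f _] := homf.
pose F : {linear rw_alg K bull -> graph_alg K bull} :=
  HB.pack f (GRing.isLinear.Build _ _ _ _ f lin_f).
rewrite -[f]/(F : _ -> _) [in LHS](row_sum_delta x) linear_sum.
by apply: eq_bigr => i _; rewrite linearZ.
Qed.

Lemma bull_hom_img : bull_hom img.
Proof.
have [lin_f mor_f] := homf.
pose F : {linear rw_alg K bull -> graph_alg K bull} :=
  HB.pack f (GRing.isLinear.Build _ _ _ _ f lin_f).
have fZ c x : c != 0 -> c *: f (c^-1 *: x) = f x.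
  by move=> c0; rewrite -[f]/(F : _ -> _) linearZ scalerA divff ?scale1r.
have fD x y : f (x + y) = f x + f y by exact: (linearD F).
have [t1 t2 t3 t4 t5] := bull_rw_alg_table K.
split=> [i j ij|||||];
  rewrite -[evol_mul (adjmx _ _)]/(@alg_mul K (graph_alg K bull)) -mor_f.
- rewrite /= evol_mul_basis (negPf ij); exact: (linear0 F).
- by rewrite t1.
- by rewrite t2.
- by rewrite t3 fZ // !fD.
- by rewrite t4 fZ // !fD.
- by rewrite t5 fZ // !fD.
Qed.

Lemma alg_hom_eq0 : (forall i, img i = 0) -> forall x, f x = 0.
Proof.
by move=> img0 x; rewrite alg_hom_sum big1 // => i _; rewrite img0 scaler0.
Qed.

Lemma alg_hom_not_surjective : exists y, forall x, f x != y.
Proof.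
have e1 : (delta_mx 0 (vtx 1) : 'rV[K]_5) 0 (vtx 1) = 1 by rewrite mxE !eqxx.
have [img0|[i [j [k [ij ik jk nz]]]]] := bull_hom_triple K2 bull_hom_img.
  exists (delta_mx 0 (vtx 1) : 'rV[K]_5) => x; rewrite (alg_hom_eq0 img0).
  by rewrite eq_sym; apply/rV0Pn; exists (vtx 1); rewrite e1 oner_neq0.
have col := bull_hom_triple_col bull_hom_img ij ik jk nz.
move: nz; rewrite !mulf_eq0 !negb_or => /andP[/andP[i1 _] _].
(* By [col] the image lies in a hyperplane relating coordinates 1 and 2, and e_2 is off it because
   [img i] has a nonzero first entry. *)
exists (delta_mx 0 (vtx 2) : 'rV[K]_5) => x; apply: contra_neq i1 => fx.
have : img i 0 (vtx 1) * (f x : 'rV[K]_5) 0 (vtx 2) =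
       img i 0 (vtx 2) * (f x : 'rV[K]_5) 0 (vtx 1).
  rewrite alg_hom_sum !summxE !mulr_sumr; apply: eq_bigr => l _.
  by rewrite !mxE mulrCA col mulrCA.
by rewrite fx !mxE !vtx_eq //= mulr1 mulr0.
Qed.

End BullAlgebraHom.

(* If i ^+ 2 = -1 in K, then e_1, e_2 |-> v, e_5 |-> - v, e_3, e_4 |-> 0, with
   v = e_1 + e_2 + i e_5, is a nonzero homomorphism; hence the first clause
   excludes such K. Non-isomorphism needs no such restriction. *)
Theorem mainTheorem4 :
  [/\ twin_free bull, singular bull
    & forall K : fieldType, (2 : K) != 0 -> (3 : K) != 0 ->
      ((forall i : K, i ^+ 2 != -1) ->
         forall f : rw_alg K bull -> graph_alg K bull,
           alg_hom f -> forall x, f x = 0)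
      /\ ~ alg_isomorphic (rw_alg K bull) (graph_alg K bull)].
Proof.
split; [exact: bull_twin_free | exact: bull_singular | move=> K K2 K3; split].
  move=> sqrtN1 f homf; apply: alg_hom_eq0 => // i.
  have homa := bull_hom_img K2 K3 homf.
  have [->//|[j [k [l [jk jl kl nz]]]]] := bull_hom_triple K2 homa.
  have [t /eqP] := bull_hom_triple_sqrtN1 homa jk jl kl nz.
  by rewrite (negPf (sqrtN1 t)).
move=> [f [homf [g _ gK]]].
have [y /(_ (g y))] := alg_hom_not_surjective K2 K3 homf.
by rewrite gK eqxx.
Qed.
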